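(* Let $1/3<r\le1$. Let $\xi:[0,1]\to\mathbb{R}^d$ and $\Gamma:\{0\le s\le t\le1\}\to\mathbb{R}^d\otimes\mathbb{R}^d$ satisfy, for some constant $\mu$, $$|\xi(t)-\xi(s)|\le\mu(t-s)^r,\qquad|\Gamma(s,t)|\le\mu(t-s)^{2r}\qquad(s\le t)$$ and the multiplicative property $$\Gamma(s,t)=\Gamma(s,u)+\Gamma(u,t)+\bigl(\xi(u)-\xi(s)\bigr)\otimes\bigl(\xi(t)-\xi(u)\bigr)\qquad(s\le u\le t).$$ Let $\rho:[0,1]\to\mathcal{L}(\mathbb{R}^d,\mathbb{R}^n)$ (the space of linear maps) and $\Phi:[0,1]\to\mathcal{L}(\mathbb{R}^d,\mathcal{L}(\mathbb{R}^d,\mathbb{R}^n))=\mathcal{L}(\mathbb{R}^d\otimes\mathbb{R}^d,\mathbb{R}^n)$ be paths such that, for some constant $\mu'$ and all $s\le t$, $$\bigl|\rho(t)-\rho(s)-\Phi(s)\bigl(\xi(t)-\xi(s)\bigr)\bigr|\le\mu'(t-s)^{2r},\qquad|\Phi(t)-\Phi(s)|\le\mu'(t-s)^r.$$ For any $s<t$ and any subdivision $\Sigma=(t_k)$ of $[s,t]$, put $$g(\Sigma):=\sum_k\Bigl(\rho(t_k)\bigl(\xi(t_{k+1})-\xi(t_k)\bigr)+\Phi(t_k)\Gamma(t_k,t_{k+1})\Bigr).$$ Then $g(\Sigma)$ converges as $\max_k(t_{k+1}-t_k)$ tends to $0$, and the limit, denoted $\int_s^t\rho\,d\xi$, satisfies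 $$\Bigl|\int_s^t\rho\,d\xi-\rho(s)\bigl(\xi(t)-\xi(s)\bigr)-\Phi(s)\Gamma(s,t)\Bigr|\le C\,\mu\,\mu'\,(t-s)^{3r}$$ for some $C=C(r)$.
   Context: The identification $\mathcal{L}(\mathbb{R}^d,\mathcal{L}(\mathbb{R}^d,\mathbb{R}^n))=\mathcal{L}(\mathbb{R}^d\otimes\mathbb{R}^d,\mathbb{R}^n)$ is made through $[G(x)](y)=G(x\otimes y)$. Spaces of linear maps and tensors carry the usual (compatible) norms, e.g. operator norms and a tensor norm with $|x\otimes y|\le|x||y|$ such that $|G(z)|\le|G|\,|z|$ for $G\in\mathcal{L}(\mathbb{R}^d\otimes\mathbb{R}^d,\mathbb{R}^n)$. *)

(* Defs.v *)
From HB Require Import structures.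
From mathcomp Require Export all_boot all_order all_algebra.
From mathcomp Require Export all_classical all_reals all_analysis.
Export Order.TTheory GRing.Theory Num.Theory.
Export numFieldNormedType.Exports.

Set Implicit Arguments.
Unset Strict Implicit.
Unset Printing Implicit Defensive.

Local Open Scope classical_set_scope.
Local Open Scope ring_scope.

(* R^d (x) R^d is modelled by the d x d matrices: (x (x) y)_ij = x_i * y_j. *)
Definition tensor (R : realType) (d : nat) (x y : 'rV[R]_d) : 'M[R]_d :=
  x^T *m y.

(* The identification of L(R^d (x) R^d, R^n) with L(R^d, L(R^d, R^n)); its
   defining property [G(x)](y) = G(x (x) y) is tensor_curryE. *)
Definition tensor_curry (R : realType) (d n : nat)
    (G : 'Hom('M[R]_d, 'rV[R]_n)) : 'Hom('rV[R]_d, 'Hom('rV[R]_d, 'rV[R]_n)) :=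
  linfun (fun x : 'rV[R]_d => (G \o linfun (mulmx x^T))%VF).

Lemma tensor_curryE (R : realType) (d n : nat) (G : 'Hom('M[R]_d, 'rV[R]_n))
  (x y : 'rV[R]_d) : tensor_curry G x y = G (tensor x y).
Proof.
pose f (x : 'rV[R]_d) := (G \o linfun (mulmx x^T))%VF.
have f_lin : linear f.
  move=> a u v; apply/lfunP => z.
  by rewrite !lfunE /= !lfunE /= !comp_lfunE !lfunE /= linearP /= mulmxDl
    -scalemxAl linearP.
pose fL : {linear 'rV[R]_d -> 'Hom('rV[R]_d, 'rV[R]_n)} :=
  HB.pack f (GRing.isLinear.Build _ _ _ _ f f_lin).
by rewrite /tensor_curry (lfunE fL) /= /f comp_lfunE lfunE.
Qed.

Lemma tensor_curry_bij (R : realType) (d n : nat) :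
  bijective (@tensor_curry R d n).
Proof.
pose f (H : 'Hom('rV[R]_d, 'Hom('rV[R]_d, 'rV[R]_n))) (z : 'M[R]_d) :=
  \sum_i \sum_j z i j *: H (delta_mx 0 i) (delta_mx 0 j).
have f_lin H : linear (f H).
  move=> a u v; rewrite /f scaler_sumr -big_split /=; apply: eq_bigr => i _.
  rewrite scaler_sumr -big_split /=; apply: eq_bigr => j _.
  by rewrite !mxE scalerDl scalerA.
pose fL H : {linear 'M[R]_d -> 'rV[R]_n} :=
  HB.pack (f H) (GRing.isLinear.Build _ _ _ _ (f H) (f_lin H)).
exists (fun H => linfun (fL H)) => [G|H].
  apply/lfunP => z; rewrite lfunE /= /f.
  under eq_bigr do under eq_bigr do rewrite tensor_curryE -linearZ.
  under eq_bigr do rewrite -linear_sum.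
  rewrite -linear_sum [in RHS](matrix_sum_delta z); congr (G _).
  apply: eq_bigr => i _; apply: eq_bigr => j _; congr (_ *: _).
  by rewrite /tensor trmx_delta mul_delta_mx.
apply/lfunP => x; apply/lfunP => y; rewrite tensor_curryE lfunE /= /f.
rewrite {2}(row_sum_delta x) linear_sum sum_lfunE; apply: eq_bigr => i _.
rewrite linearZ /= scale_lfunE {2}(row_sum_delta y) linear_sum scaler_sumr.
apply: eq_bigr => j _; rewrite linearZ /= scalerA; congr (_ *: _).
by rewrite /tensor mxE big_ord1 !mxE.
Qed.

Record is_norm (R : realType) (V : lmodType R) (N : V -> R) : Prop := IsNorm {
  is_norm_eq0 : forall x, N x = 0 -> x = 0;
  is_normD : forall x y, N (x + y) <= N x + N y;
  is_normZ : forall a x, N (a *: x) = `|a| * N x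
}.

(* Norms on R^d, R^d (x) R^d, R^n, L(R^d, R^n) and L(R^d (x) R^d, R^n). *)
Record compatible_norms (R : realType) (d n : nat)
    (Nd : 'rV[R]_d -> R) (Nt : 'M[R]_d -> R) (Nn : 'rV[R]_n -> R)
    (Nl : 'Hom('rV[R]_d, 'rV[R]_n) -> R) (Nb : 'Hom('M[R]_d, 'rV[R]_n) -> R)
    : Prop := CompatibleNorms {
  vec_norm : is_norm Nd;
  tensor_norm : is_norm Nt;
  out_norm : is_norm Nn;
  lin_norm : is_norm Nl;
  bilin_norm : is_norm Nb;
  tensor_norm_le : forall x y, Nt (tensor x y) <= Nd x * Nd y;
  lin_norm_le : forall (L : 'Hom('rV[R]_d, 'rV[R]_n)) x, Nn (L x) <= Nl L * Nd x;
  bilin_norm_le : forall (G : 'Hom('M[R]_d, 'rV[R]_n)) z, Nn (G z) <= Nb G * Nt z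
}.

(* As in itv_partition, the sequence S lists t_1 < ... < t_N = t, the left
   endpoint t_0 = s being left out; so nth t (s :: S) k = t_k. *)
Definition mesh (R : realType) (s t : R) (S : seq R) : R :=
  \big[Num.max/0]_(0 <= k < size S)
     (nth t (s :: S) k.+1 - nth t (s :: S) k).

Definition mesh_filter (R : realType) (s t : R) : set_system (seq R) :=
  filter_from [set e : R | 0 < e]
    (fun e => [set S | itv_partition s t S /\ mesh s t S < e]).

Global Instance mesh_filter_filter (R : realType) (s t : R) :
  Filter (mesh_filter s t).
Proof.
apply: filter_from_filter; first by exists 1 => /=.
move=> e1 e2 /= e1_gt0 e2_gt0; exists (Num.min e1 e2).
  by rewrite /= lt_min e1_gt0.
by move=> S [pS]; rewrite lt_min => /andP[? ?].
Qed.

Lemma itv_partition_mesh_lt (R : realType) (s t e : R) : s <= t -> 0 < e ->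
  exists S, itv_partition s t S /\ mesh s t S < e.
Proof.
move=> st e_gt0.
have [m] : exists m : nat, t - s < m%:R * (e / 2).
  have e2_gt0 : 0 < e / 2 by rewrite divr_gt0.
  exists (Num.truncn ((t - s) / (e / 2))).+1.
  by rewrite -ltr_pdivrMr// truncnS_gt.
elim: m s st => [s st|m IH s st tsm].
  by rewrite mul0r subr_lt0 ltNge st.
have [<-|s_neq_t] := eqVneq s t.
  by exists [::]; split; [split=> /=|rewrite /mesh big_geq].
have s_lt_t : s < t by rewrite lt_neqAle s_neq_t.
have e2_lt : e / 2 < e by rewrite ltr_pdivrMr// ltr_pMr// ltr1n.
have [ts_lt|ts_ge] := ltP (t - s) (e / 2).
  exists [:: t]; split; first exact: itv_partition1.
  by rewrite /mesh /= big_nat_recl// big_geq//= gt_max (lt_trans ts_lt).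
have [||S [[pS lS] mS]] := IH (s + e / 2).
- by rewrite addrC -lerBrDr.
- by rewrite opprD addrA ltrBlDr (lt_le_trans tsm)// -natr1 mulrDl mul1r.
exists (s + e / 2 :: S); split.
  by split=> //=; rewrite pS ltrDl divr_gt0.
by rewrite /mesh /= big_nat_recl//= gt_max addrAC subrr add0r e2_lt.
Qed.

Global Instance mesh_filter_proper (R : realType) (s t : R) (st : s <= t) :
  ProperFilter (mesh_filter s t).
Proof.
apply: filter_from_proper => e /= e_gt0.
by have [S ?] := itv_partition_mesh_lt st e_gt0; exists S.
Qed.

Definition compensated_sum (R : realType) (d n : nat)
    (xi : R -> 'rV[R]_d) (Gamma : R -> R -> 'M[R]_d)
    (rho : R -> 'Hom('rV[R]_d, 'rV[R]_n))
    (Phi : R -> 'Hom('M[R]_d, 'rV[R]_n))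
    (s t : R) (S : seq R) : 'rV[R]_n :=
  let tau := nth t (s :: S) in
  \sum_(0 <= k < size S)
     (rho (tau k) (xi (tau k.+1) - xi (tau k))
      + Phi (tau k) (Gamma (tau k) (tau k.+1))).

Definition rough_integral (R : realType) (d n : nat)
    (xi : R -> 'rV[R]_d) (Gamma : R -> R -> 'M[R]_d)
    (rho : R -> 'Hom('rV[R]_d, 'rV[R]_n))
    (Phi : R -> 'Hom('M[R]_d, 'rV[R]_n)) (s t : R) : 'rV[R]_n :=
  lim (compensated_sum xi Gamma rho Phi s t @ mesh_filter s t).

(* Main.v *)
Require Import Defs.
From mathcomp Require Import ring lra.

Local Open Scope classical_set_scope.
Local Open Scope ring_scope.

(* The germ a(s,t) = rho(s)(xi(t) - xi(s)) + Phi(s) Gamma(s,t) is almost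
   additive: by the multiplicative property of Gamma,
     a(s,t) - a(s,u) - a(u,t)
       = - (rho(u) - rho(s) - Phi(s)(xi(u) - xi(s))) (xi(t) - xi(u))
         - (Phi(u) - Phi(s)) Gamma(u,t),
   which is O((t - s)^(3r)) with 3r > 1. The sums of such a germ over any
   partition of [s,t] stay within O((t - s)^(3r)) of a(s,t). Applying this on
   each cell of a partition of mesh at most e bounds the effect of refining it
   by O(e^(3r-1) (t - s)); comparing two fine partitions with a common
   refinement shows that the sums are Cauchy. *)

(** * Elementary consequences of the norm axioms *)

Section NormTheory.
Set Implicit Arguments.
Unset Strict Implicit.
Variables (R : realType) (V : lmodType R) (N : V -> R).
Hypothesis hN : is_norm N.

Lemma is_norm0 : N 0 = 0.
Proof. by rewrite -(scale0r 0) (is_normZ hN) normr0 mul0r. Qed.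

Lemma is_normN x : N (- x) = N x.
Proof. by rewrite -scaleN1r (is_normZ hN) normrN1 mul1r. Qed.

Lemma is_norm_ge0 x : 0 <= N x.
Proof.
have := is_normD hN x (- x); rewrite subrr is_norm0 is_normN => h; lra.
Qed.

Lemma is_normB x y : N (x - y) <= N x + N y.
Proof. by rewrite -(is_normN y) (is_normD hN). Qed.

Lemma is_norm_dist x y z : N (x - z) <= N (x - y) + N (y - z).
Proof. by rewrite -{1}(subrK y x) -addrA (is_normD hN). Qed.

Lemma is_norm_sum (I : Type) (r : seq I) (F : I -> V) :
  N (\sum_(i <- r) F i) <= \sum_(i <- r) N (F i).
Proof.
elim/big_rec2: _ => [|i y x _ h]; first by rewrite is_norm0.
by rewrite (le_trans (is_normD hN _ _))// lerD2l.
Qed.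

End NormTheory.

(** * Equivalence of an arbitrary norm on row vectors with the sup norm, which defines their
    topology *)

Section EquivalenceOfNorms.
Set Implicit Arguments.
Unset Strict Implicit.
Variables (R : realType) (n : nat) (N : 'rV[R]_n -> R).
Hypothesis hN : is_norm N.

Lemma ler_mx_entry (x : 'rV[R]_n) i : `|x 0 i| <= `|x|.
Proof.
by rewrite [leRHS]/Num.norm /= mx_normrE; apply/bigmax_geP; right => /=; exists (0, i).
Qed.

(** Expand [x] in the canonical basis. The extra [1] keeps the constant positive even if [n = 0]. *)
Lemma is_norm_rV_le : exists2 c, 0 < c & forall x, N x <= c * `|x|.
Proof.
exists (1 + \sum_(i < n) N (delta_mx 0 i)) => [|x].
  by rewrite ltr_wpDr// sumr_ge0// => i _; exact: is_norm_ge0.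
rewrite {1}(row_sum_delta x) (le_trans (is_norm_sum hN _ _))// mulrDl mul1r.
rewrite ler_wpDl// mulr_suml; apply: ler_sum => i _.
by rewrite (is_normZ hN) mulrC ler_wpM2l ?is_norm_ge0// ler_mx_entry.
Qed.

Lemma is_norm_rV_continuous : continuous N.
Proof.
have [c c0 Nle] := is_norm_rV_le.
move=> x; apply/(@cvgrPdist_le R R^o _ (nbhs x) (nbhs_filter x)) => e e0.
apply/(@nbhs_normP R 'rV[R]_n); exists (e / c) => /=; first by rewrite divr_gt0.
move=> y /=; rewrite ltr_pdivlMr// mulrC => /ltW xy.
apply: le_trans xy; apply: le_trans (Nle _).
rewrite ler_norml; apply/andP; split.
  rewrite lerNl opprB lerBlDr -(is_normN hN (x - y)).
  by rewrite (le_trans _ (is_normD hN _ _))// opprB subrK.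
by rewrite lerBlDr (le_trans _ (is_normD hN _ _))// subrK.
Qed.

(** By compactness [N] attains a minimum on the unit sphere, positive since [N] vanishes only at
    [0]; homogeneity extends the bound to all vectors. *)
Lemma rV_norm_le_is_norm : exists2 c, 0 < c & forall x, `|x| <= c * N x.
Proof.
pose A := [set x : 'rV[R]_n | `|x| = 1].
have [[x0 x01]|A0] := pselect (A !=set0); last first.
  (* If the sphere is empty, every vector is [0], since a nonzero one could be normalised into it;
     any positive constant then works. *)
  exists 1 => // x; have [->|x0] := eqVneq x 0.
    by rewrite normr0 mul1r is_norm_ge0.
  by case: A0; exists (`|x|^-1 *: x); rewrite /A /= normrZ normfV normr_id mulVf// normr_eq0.
have cA : compact A.
  apply: bounded_closed_compact.
    by exists 1; split => // M M1 x /= ->; rewrite ltW.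
  have -> : A = Num.norm @^-1` [set 1] by [].
  apply: closed_comp; last exact: closed_eq.
  by move=> x _; exact: norm_continuous.
have [z] := @EVT_min_rV R n N A (ex_intro _ x0 x01) cA
  (continuous_subspaceT is_norm_rV_continuous).
rewrite inE /A /= => z1 zmin.
have Nz : 0 < N z.
  rewrite lt_neqAle is_norm_ge0// andbT eq_sym; apply/eqP => /(is_norm_eq0 hN) z0.
  by move: z1; rewrite z0 normr0 => /eqP; rewrite eq_sym oner_eq0.
exists (N z)^-1 => [|x]; first by rewrite invr_gt0.
have [->|x_neq0] := eqVneq x 0; first by rewrite normr0 is_norm0// mulr0.
have x_gt0 : 0 < `|x| by rewrite normr_gt0.
have := zmin (`|x|^-1 *: x).
rewrite inE /A /= normrZ normfV normr_id mulVf ?gt_eqF// => /(_ erefl).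
rewrite (is_normZ hN) normfV normr_id => h.
by rewrite mulrC ler_pdivlMr// -ler_pdivlMl.
Qed.

End EquivalenceOfNorms.

(** * Common refinements and mesh of partitions *)

Section Partitions.
Set Implicit Arguments.
Unset Strict Implicit.
Variable R : realType.

Lemma path_lt_le_last (s : R) S y : path <%R s S -> y \in s :: S -> y <= last s S.
Proof.
move=> + yS; case/splitPl: yS => P Q lP.
rewrite cat_path last_cat lP => /andP[_ pQ].
by apply: (@itv_partition_le _ _ y _ Q); split.
Qed.

Lemma common_refinement (s t : R) S1 S2 : itv_partition s t S1 ->
  itv_partition s t S2 -> exists U, [/\ itv_partition s t U,
    {subset S1 <= U} & {subset S2 <= U}].
Proof.
move=> [p1 /eqP l1] [p2 /eqP l2]; exists (sort <=%R (undup (S1 ++ S2))).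
have sub i : (i \in sort <=%R (undup (S1 ++ S2))) = (i \in S1) || (i \in S2).
  by rewrite mem_sort mem_undup mem_cat.
have pU : path <%R s (sort <=%R (undup (S1 ++ S2))).
  rewrite lt_path_sortedE sort_lt_sorted undup_uniq andbT; apply/allP => y.
  by rewrite sub => /orP[]; apply/allP/(order_path_min lt_trans).
split; [split => //|by move=> y yS; rewrite sub yS|by move=> y yS; rewrite sub yS orbT].
rewrite eq_le; apply/andP; split.
  have := mem_last s (sort <=%R (undup (S1 ++ S2))).
  rewrite inE sub => /or3P[/eqP ->|yS|yS].
  - by rewrite -l1 path_lt_le_last// mem_head.
  - by rewrite -l1 path_lt_le_last// inE yS orbT.
  - by rewrite -l2 path_lt_le_last// inE yS orbT.
apply: path_lt_le_last => //.
by have := mem_last s S1; rewrite l1 !inE sub => /orP[->//|->]; rewrite orbT.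
Qed.

(** Stated cell by cell, the mesh bound is inherited by tails and so suits induction on the
    partition. *)
Lemma mesh_path (d s t : R) S : mesh s t S <= d ->
  path (fun x y => y - x <= d) s S.
Proof.
move=> md; apply/(pathP t) => k kS; apply: le_trans md.
by rewrite /mesh; apply: (@le_bigmax_seq _ _ _ _ 0 k predT) => //; rewrite mem_index_iota.
Qed.

End Partitions.

(** * Sewing estimates for a germ that is almost additive on [[lo, hi]] *)

Section Sewing.
Set Implicit Arguments.
Unset Strict Implicit.
Variables (R : realType) (V : lmodType R) (N : V -> R).
Hypothesis hN : is_norm N.
Variables (a : R -> R -> V) (K theta lo hi : R).
Hypotheses (theta1 : 1 < theta) (K0 : 0 <= K).
Hypothesis defect : forall s u t, lo <= s -> s <= u -> u <= t -> t <= hi ->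
  N (a s t - a s u - a u t) <= K * (t - s) `^ theta.

(** The recursion on the list replaces indexed sums, so that partitions can be cut and
    concatenated. *)
Fixpoint partition_sum (s : R) (S : seq R) : V :=
  if S is x :: S' then a s x + partition_sum x S' else 0.

Lemma partition_sum_cat s S1 S2 : partition_sum s (S1 ++ S2) =
  partition_sum s S1 + partition_sum (last s S1) S2.
Proof. by elim: S1 s => [|x S1 IH] s /=; rewrite ?add0r// IH addrA. Qed.

Definition sewing_const : R := 2 / (1 - 2 * 2^-1 `^ theta).

Lemma powR_split (x : R) : x `^ theta = x `^ (theta - 1) * x `^ 1.
Proof.
rewrite -powRD ?subrK//; apply/implyP => /eqP h; by move: theta1; rewrite h ltr10.
Qed.

Lemma half_powR_lt : 2 * 2^-1 `^ theta < 1 :> R.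
Proof.
rewrite powR_split powRr1// mulrC -mulrA mulVf// mulr1 -[ltRHS](congr1 (@^~ (theta - 1)) (@powR1 R)) /=.
apply: gt0_ltr_powR; rewrite ?nnegrE ?subr_gt0//.
by rewrite invf_lt1// ltr1n.
Qed.

Lemma sewing_const_gt0 : 0 < sewing_const.
Proof. by rewrite divr_gt0// subr_gt0 half_powR_lt. Qed.

Lemma sewing_constE (x : R) :
  sewing_const * (2^-1 `^ theta * x) *+ 2 + 2 * x = sewing_const * x.
Proof.
have h : 1 - 2 * 2^-1 `^ theta != 0 :> R by rewrite gt_eqF// subr_gt0 half_powR_lt.
by rewrite /sewing_const; field.
Qed.

Lemma germ_diag s : lo <= s -> s <= hi -> a s s = 0.
Proof.
move=> los shi; apply: (is_norm_eq0 hN); apply/eqP; rewrite eq_le is_norm_ge0// andbT.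
have := defect los (lexx s) (lexx s) shi.
by rewrite !subrr sub0r is_normN// powR0 ?mulr0// gt_eqF// (lt_trans ltr01).
Qed.

(* The partition is cut at its last point below and its first point above the
   midpoint of [s, t]: both outer pieces have at most half the length, which
   gives a geometric recursion. *)
Lemma sewing_bound s S : lo <= s -> path <%R s S -> last s S <= hi ->
  N (partition_sum s S - a s (last s S))
    <= sewing_const * K * (last s S - s) `^ theta.
Proof.
have [m] := ubnP (size S); elim: m s S => // m IH s S Sm los pS lhi.
case: S => [|x0 S0] in Sm pS lhi *.
  rewrite /= germ_diag// subr0 is_norm0//.
  by apply: mulr_ge0 (powR_ge0 _ _); apply: mulr_ge0 => //; exact/ltW/sewing_const_gt0.
set S := x0 :: S0 in Sm pS lhi *; set t := last s S in lhi *.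
have sS : itv_partition s t S by split.
have st : s < t := @itv_partition_size_neq0 _ _ s t S isT sS.
pose mid := (s + t) / 2.
have midt : mid <= t by rewrite /mid ler_pdivrMr// mulr_natr mulr2n lerD2r ltW.
have hasS : has (>= mid) S by apply/hasP; exists t => //; rewrite /t/= mem_last.
(* [x] is the first partition point at or beyond the midpoint, and [P] consists of the points before
   it. *)
have [P [x [Q [SE xmid Pmid]]]] : exists P x Q,
    [/\ S = P ++ x :: Q, mid <= x & ~~ has (>= mid) P].
  by case: (split_find hasS) => x P Q ? ?; exists P, x, Q; rewrite cat_rcons.
have tE : t = last x Q by rewrite /t SE last_cat.
rewrite SE cat_path /= in pS; case/and3P: pS => pP px pQ.
set p := last s P in px *.
have sp : s <= p by apply: (@itv_partition_le _ _ s p P); split => //.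
have xt : x <= t by apply: (@itv_partition_le _ _ x t Q); split; rewrite ?tE.
have p_mid : p <= mid.
  rewrite /p; case: (P) (Pmid) => [_|y P' /hasPn h].
    by rewrite /= /mid ler_pdivlMr// mulr_natr mulr2n lerD2l ltW.
  by rewrite /= ltW// ltNge h//= mem_last.
have [sP sQ] : (size P < m)%N /\ (size Q < m)%N.
  have : (size P + (size Q).+1 <= m)%N by move: Sm; rewrite ltnS SE size_cat.
  by rewrite addnS => h; split; apply: leq_ltn_trans h; rewrite ?leq_addr ?leq_addl.
have := IH _ _ sP los pP _; rewrite -/p => /(_ _) IHP.
have := IH _ _ sQ _ pQ _; rewrite -tE => /(_ _) IHQ.
have pt : p <= t := le_trans (ltW px) xt.
have lop : lo <= p := le_trans los sp.
have lox : lo <= x := le_trans lop (ltW px).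
have {}IHP := IHP (le_trans pt lhi).
have {}IHQ := IHQ lox lhi.
have D1 := defect los sp pt lhi.
have D2 := defect lop (ltW px) xt lhi.
have M0 := sewing_const_gt0.
have theta_ge0 : 0 <= theta := le_trans ler01 (ltW theta1).
have half y : 0 <= y -> y <= (t - s) / 2 ->
    y `^ theta <= 2^-1 `^ theta * (t - s) `^ theta.
  move=> y0 yle; rewrite -powRM ?invr_ge0 ?subr_ge0 ?(ltW st)// (mulrC 2^-1).
  by apply: ge0_ler_powR; rewrite ?nnegrE// divr_ge0// subr_ge0 ltW.
have MK0 : 0 <= sewing_const * K by rewrite mulr_ge0// ltW.
have H1 : (p - s) `^ theta <= 2^-1 `^ theta * (t - s) `^ theta.
  by apply: half; rewrite ?subr_ge0//; move: p_mid; rewrite /mid => h; lra.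
have H2 : (t - x) `^ theta <= 2^-1 `^ theta * (t - s) `^ theta.
  by apply: half; rewrite ?subr_ge0//; move: xmid; rewrite /mid => h; lra.
have H3 : (t - p) `^ theta <= (t - s) `^ theta.
  by apply: ge0_ler_powR; rewrite ?nnegrE ?subr_ge0 ?lerB// ltW.
have -> : partition_sum s S = partition_sum s P + (a p x + partition_sum x Q).
  by rewrite SE partition_sum_cat.
(* The cell from [p] to [x] may be long, so its germ is kept as it is. [T1] replaces the two outer
   sums by single germs, by induction; [T2] and [T3] then remove [x] and [p] at the cost of one
   defect each. *)
have T1 : N (partition_sum s P + (a p x + partition_sum x Q)
    - (a s p + (a p x + a x t)))
    <= sewing_const * K * (2^-1 `^ theta * (t - s) `^ theta) *+ 2.
  rewrite opprD addrACA opprD (addrACA (a p x)) subrr add0r.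
  apply: le_trans (is_normD hN _ _) _; rewrite mulr2n lerD//.
    by apply: le_trans IHP _; rewrite ler_wpM2l.
  by apply: le_trans IHQ _; rewrite ler_wpM2l.
have T2 : N (a s p + (a p x + a x t) - (a s p + a p t))
    <= K * (t - s) `^ theta.
  rewrite opprD addrACA subrr add0r -(is_normN hN) opprB opprD addrA.
  by apply: le_trans D2 _; rewrite ler_wpM2l.
have T3 : N (a s p + a p t - a s t) <= K * (t - s) `^ theta.
  by rewrite -(is_normN hN) opprB opprD addrA.
apply: le_trans (is_norm_dist hN _ (a s p + (a p x + a x t)) _) _.
apply: le_trans (lerD T1 (is_norm_dist hN _ (a s p + a p t) _)) _.
apply: le_trans (lerD (lexx _) (lerD T2 T3)) _.
have := sewing_constE (K * (t - s) `^ theta); set A := (t - s) `^ theta.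
set c := sewing_const; set b := _ `^ theta => E.
have -> : c * K * A = c * (K * A) by rewrite mulrA.
rewrite -E le_eqVlt; apply/orP; left; apply/eqP; ring.
Qed.

(** On a cell of length [l <= d] the sewing bound gives [l]^ theta <= d [^ (theta - 1) * l], and the
    lengths [l] add up to the total length. *)
Lemma refinement_bound (d s : R) S S' : lo <= s -> last s S <= hi ->
  path <%R s S -> path (fun x y => y - x <= d) s S ->
  path <%R s S' -> {subset S <= S'} -> last s S' = last s S ->
  N (partition_sum s S' - partition_sum s S)
    <= sewing_const * K * d `^ (theta - 1) * (last s S - s).
Proof.
elim: S s S' => [|x S IH] s S' los lhi.
  move=> _ _ pS' _ /= S's; rewrite (@itv_partitionxx _ _ s S').
    by rewrite /= !subrr mulr0 is_norm0.
  by split => //; rewrite S's.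
move=> /= /andP[sx pS] /andP[xd pd] pS' SS' lS'.
have xS' : x \in S' by rewrite SS'// mem_head.
case/path.splitP: xS' => P Q in pS' SS' lS' *.
move: pS' lS'; rewrite cat_path last_cat last_rcons => /andP[pP pQ] lQ.
(* The later points of [S] lie strictly beyond [x], whereas those of [P] do not; so they all belong
   to [Q]. *)
have SQ : {subset S <= Q}.
  move=> y yS; have : y \in rcons P x ++ Q by rewrite SS'// inE yS orbT.
  have xy : x < y by move/(order_path_min lt_trans)/allP : pS; apply.
  rewrite mem_cat => /orP[yP|//].
  have := path_lt_le_last pP (y := y).
  by rewrite inE yP orbT last_rcons leNgt xy => /(_ isT).
have xt : x <= last x S by apply: (@itv_partition_le _ _ x _ S); split.
have H1 := sewing_bound los pP; rewrite last_rcons in H1.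
have {}H1 := H1 (le_trans xt lhi).
have H2 := IH x Q (le_trans los (ltW sx)) lhi pS pd pQ SQ lQ.
rewrite partition_sum_cat last_rcons opprD addrACA.
apply: le_trans (is_normD hN _ _) _.
have -> : last x S - s = (x - s) + (last x S - x) by rewrite [RHS]addrC subrKA.
rewrite mulrDr lerD// (le_trans H1)// -[leRHS]mulrA ler_wpM2l//.
  by rewrite mulr_ge0// ltW// sewing_const_gt0.
rewrite powR_split powRr1 ?subr_ge0 ?(ltW sx)// ler_wpM2r ?subr_ge0 ?(ltW sx)//.
apply: ge0_ler_powR; rewrite ?nnegrE ?subr_ge0 ?(ltW sx) ?(ltW theta1)//.
by rewrite (le_trans _ xd)// subr_ge0 ltW.
Qed.

Lemma partition_sum_dist (d s t : R) S1 S2 : lo <= s -> t <= hi ->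
  itv_partition s t S1 -> itv_partition s t S2 ->
  path (fun x y => y - x <= d) s S1 -> path (fun x y => y - x <= d) s S2 ->
  N (partition_sum s S1 - partition_sum s S2)
    <= 2 * (sewing_const * K * (t - s)) * d `^ (theta - 1).
Proof.
move=> los thi P1 P2 d1 d2; have [U [[pU /eqP lU] S1U S2U]] := common_refinement P1 P2.
case: P1 P2 => [p1 /eqP l1] [p2 /eqP l2].
apply: le_trans (is_norm_dist hN _ (partition_sum s U) _) _.
rewrite -(is_normN hN (_ - partition_sum s U)) opprB.
have H1 := @refinement_bound d s S1 U los _ p1 d1 pU S1U _.
have H2 := @refinement_bound d s S2 U los _ p2 d2 pU S2U _.
rewrite l1 in H1; rewrite l2 in H2.
apply: le_trans (lerD (H1 thi lU) (H2 thi lU)) _.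
rewrite le_eqVlt; apply/orP; left; apply/eqP; ring.
Qed.

End Sewing.

(** * Convergence of the sums along the mesh filter, and the bound on the limit *)

Section SewingLimit.
Set Implicit Arguments.
Unset Strict Implicit.
Variables (R : realType) (n : nat) (N : 'rV[R]_n -> R).
Hypothesis hN : is_norm N.
Variables (a : R -> R -> 'rV[R]_n) (K theta lo hi s t : R).
Hypotheses (theta1 : 1 < theta) (K0 : 0 <= K).
Hypothesis defect : forall s u t, lo <= s -> s <= u -> u <= t -> t <= hi ->
  N (a s t - a s u - a u t) <= K * (t - s) `^ theta.
Hypotheses (los : lo <= s) (st : s < t) (thi : t <= hi).

(** Row vectors are complete, so it suffices that all sums of small enough mesh lie in a ball around
    one of them. *)
Lemma sewing_cvg : cvg (partition_sum a s @ mesh_filter s t).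
Proof.
have FF := mesh_filter_proper (ltW st).
apply/cauchy_cvgP/cauchy_exP => e e0.
have [c c0 Nle] := rV_norm_le_is_norm hN.
pose B := 2 * (sewing_const theta * K * (t - s)).
have B0 : 0 <= B.
  by rewrite mulr_ge0// mulr_ge0 ?subr_ge0 ?(ltW st)// mulr_ge0// ltW// sewing_const_gt0.
pose h := e / (c * (B + 1)).
have h0 : 0 < h by rewrite divr_gt0// mulr_gt0// ltr_wpDl.
pose d := h `^ (theta - 1)^-1.
have d0 : 0 < d by rewrite powR_gt0.
have dE : d `^ (theta - 1) = h.
  by rewrite /d -powRrM mulVf ?powRr1 ?(ltW h0)// subr_eq0 gt_eqF.
have [S0 [P0 m0]] := itv_partition_mesh_lt (ltW st) d0.
exists (partition_sum a s S0).
exists d => // S [PS mS] /=; rewrite -ball_normE /=.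
apply: le_lt_trans (Nle _) _.
have := partition_sum_dist hN theta1 K0 defect los thi P0 PS
  (mesh_path (ltW m0)) (mesh_path (ltW mS)).
rewrite dE -/B -(ler_pM2l c0) => /le_lt_trans; apply.
have -> : e = h * (c * (B + 1)) by rewrite divfK// gt_eqF// mulr_gt0// ltr_wpDl.
have -> : h * (c * (B + 1)) = c * (B * h) + c * h by ring.
by rewrite ltrDl mulr_gt0.
Qed.

(** The estimate of [sewing_bound] is uniform in the partition, so it passes to the limit by
    continuity of [N]. *)
Lemma sewing_lim_bound :
  N (lim (partition_sum a s @ mesh_filter s t) - a s t)
    <= sewing_const theta * K * (t - s) `^ theta.
Proof.
have FF := mesh_filter_proper (ltW st).
set l := lim _.
have cl : (fun S => N (partition_sum a s S - a s t)) @ mesh_filter s t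
    --> (N (l - a s t) : R^o).
  apply: (@cvg_comp _ _ _ (fun S => partition_sum a s S - a s t) N _ (nbhs (l - a s t))).
    by apply: cvgB; [exact: sewing_cvg|exact: cvg_cst].
  exact: is_norm_rV_continuous.
(* The mesh threshold [1] is arbitrary, as the bound holds for every partition. *)
apply: (cvgr_to_le cl); exists 1 => //= S [[pS /eqP lS] _] /=.
by have := sewing_bound hN theta1 K0 defect los pS; rewrite lS => /(_ thi).
Qed.

End SewingLimit.

(** * The germ of the rough integral and its defect *)

Section RoughGerm.
Set Implicit Arguments.
Unset Strict Implicit.
Variables (R : realType) (d n : nat).
Variables (xi : R -> 'rV[R]_d) (Gamma : R -> R -> 'M[R]_d).
Variables (rho : R -> 'Hom('rV[R]_d, 'rV[R]_n)).
Variables (Phi : R -> 'Hom('M[R]_d, 'rV[R]_n)).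

Definition rough_germ (s t : R) : 'rV[R]_n :=
  rho s (xi t - xi s) + Phi s (Gamma s t).

Lemma compensated_sumE s t :
  compensated_sum xi Gamma rho Phi s t = partition_sum rough_germ s.
Proof.
apply/funext => S; elim: S s => [|x S IH] s.
  by rewrite /compensated_sum big_geq.
by rewrite /compensated_sum /= big_nat_recl//=; congr (_ + _); exact: IH.
Qed.

(** The multiplicative property produces [Phi s] applied to a tensor; uncurried, this is exactly the
    first-order correction to [rho u - rho s]. *)
Lemma rough_germ_defectE s u t :
  Gamma s t = Gamma s u + Gamma u t + tensor (xi u - xi s) (xi t - xi u) ->
  rough_germ s t - rough_germ s u - rough_germ u t =
  - (rho u - rho s - tensor_curry (Phi s) (xi u - xi s)) (xi t - xi u)
  - (Phi u - Phi s) (Gamma u t).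
Proof.
move=> GE; rewrite /rough_germ GE.
have -> : xi t - xi s = (xi t - xi u) + (xi u - xi s) by rewrite subrKA.
rewrite !(add_lfunE, opp_lfunE) tensor_curryE !linearD /=.
by apply/rowP => i; rewrite !mxE; ring.
Qed.

Variables (Nd : 'rV[R]_d -> R) (Nt : 'M[R]_d -> R) (Nn : 'rV[R]_n -> R).
Variables (Nl : 'Hom('rV[R]_d, 'rV[R]_n) -> R).
Variables (Nb : 'Hom('M[R]_d, 'rV[R]_n) -> R).
Variables (r mu mu' : R).
Hypotheses (hN : compatible_norms Nd Nt Nn Nl Nb) (r0 : 0 < r).
Hypothesis hxi : forall s t : R, 0 <= s -> s <= t -> t <= 1 ->
  Nd (xi t - xi s) <= mu * (t - s) `^ r.
Hypothesis hGamma : forall s t : R, 0 <= s -> s <= t -> t <= 1 ->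
  Nt (Gamma s t) <= mu * (t - s) `^ (2 * r).
Hypothesis hchen : forall s u t : R, 0 <= s -> s <= u -> u <= t -> t <= 1 ->
  Gamma s t = Gamma s u + Gamma u t + tensor (xi u - xi s) (xi t - xi u).
Hypothesis hrho : forall s t : R, 0 <= s -> s <= t -> t <= 1 ->
  Nl (rho t - rho s - tensor_curry (Phi s) (xi t - xi s))
    <= mu' * (t - s) `^ (2 * r).
Hypothesis hPhi : forall s t : R, 0 <= s -> s <= t -> t <= 1 ->
  Nb (Phi t - Phi s) <= mu' * (t - s) `^ r.

(** On the interval from [0] to [1] the power factor is positive, so each constant inherits the sign
    of a norm. *)
Lemma holder_consts_ge0 : 0 <= mu /\ 0 <= mu'.
Proof.
have p0 : 0 < (1 - 0 : R) `^ r by rewrite powR_gt0 ?subr_gt0.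
split; rewrite -(pmulr_lge0 _ p0).
  exact: le_trans (is_norm_ge0 (vec_norm hN) _) (hxi (lexx 0) ler01 (lexx 1)).
exact: le_trans (is_norm_ge0 (bilin_norm hN) _) (hPhi (lexx 0) ler01 (lexx 1)).
Qed.

(** Each of the two terms pairs a factor of order [2 * r] with one of order [r], and contributes one
    [mu * mu']. *)
Lemma rough_germ_defect s u t : 0 <= s -> s <= u -> u <= t -> t <= 1 ->
  Nn (rough_germ s t - rough_germ s u - rough_germ u t)
    <= 2 * mu * mu' * (t - s) `^ (3 * r).
Proof.
move=> s0 su ut t1; have [mu0 mu'0] := holder_consts_ge0.
have u0 := le_trans s0 su; have u1 := le_trans ut t1.
rewrite (rough_germ_defectE (hchen s0 su ut t1)).
apply: le_trans (is_normB (out_norm hN) _ _) _; rewrite (is_normN (out_norm hN)).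
have le1 q : 0 <= q -> (u - s) `^ q <= (t - s) `^ q.
  by move=> q0; apply: ge0_ler_powR; rewrite ?nnegrE ?subr_ge0 ?lerB// (le_trans su).
have le2 q : 0 <= q -> (t - u) `^ q <= (t - s) `^ q.
  by move=> q0; apply: ge0_ler_powR; rewrite ?nnegrE ?subr_ge0 ?lerB// (le_trans su).
have r2 : 0 <= 2 * r by rewrite mulr_ge0// ltW.
have E : (t - s) `^ (3 * r) = (t - s) `^ (2 * r) * (t - s) `^ r.
  have -> : 3 * r = 2 * r + r by ring.
  (* Since [t - s] may vanish, the power law relies on the exponent sum being nonzero. *)
  by rewrite powRD// gt_eqF// ltr_wpDl.
have -> : 2 * mu * mu' * (t - s) `^ (3 * r) =
    (mu' * (t - s) `^ (2 * r)) * (mu * (t - s) `^ r)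
  + (mu' * (t - s) `^ r) * (mu * (t - s) `^ (2 * r)) by rewrite E; ring.
apply: lerD.
  apply: le_trans (lin_norm_le hN _ _) _.
  apply: ler_pM; rewrite ?(is_norm_ge0 (lin_norm hN)) ?(is_norm_ge0 (vec_norm hN))//.
    by apply: le_trans (hrho s0 su u1) _; rewrite ler_wpM2l// le1.
  by apply: le_trans (hxi u0 ut t1) _; rewrite ler_wpM2l// le2// ltW.
apply: le_trans (bilin_norm_le hN _ _) _.
apply: ler_pM; rewrite ?(is_norm_ge0 (bilin_norm hN)) ?(is_norm_ge0 (tensor_norm hN))//.
  by apply: le_trans (hPhi s0 su u1) _; rewrite ler_wpM2l// le1// ltW.
by apply: le_trans (hGamma u0 ut t1) _; rewrite ler_wpM2l// le2.
Qed.

End RoughGerm.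

Theorem theoremA5 (R : realType) (r : R) (hr : 1 / 3 < r <= 1) :
  exists C : R, forall (d n : nat)
    (Nd : 'rV[R]_d -> R) (Nt : 'M[R]_d -> R) (Nn : 'rV[R]_n -> R)
    (Nl : 'Hom('rV[R]_d, 'rV[R]_n) -> R) (Nb : 'Hom('M[R]_d, 'rV[R]_n) -> R)
    (xi : R -> 'rV[R]_d) (Gamma : R -> R -> 'M[R]_d) (mu : R)
    (rho : R -> 'Hom('rV[R]_d, 'rV[R]_n))
    (Phi : R -> 'Hom('M[R]_d, 'rV[R]_n)) (mu' : R),
  compatible_norms Nd Nt Nn Nl Nb ->
  (forall s t : R, 0 <= s -> s <= t -> t <= 1 ->
     Nd (xi t - xi s) <= mu * (t - s) `^ r) ->
  (forall s t : R, 0 <= s -> s <= t -> t <= 1 ->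
     Nt (Gamma s t) <= mu * (t - s) `^ (2 * r)) ->
  (forall s u t : R, 0 <= s -> s <= u -> u <= t -> t <= 1 ->
     Gamma s t = Gamma s u + Gamma u t + tensor (xi u - xi s) (xi t - xi u)) ->
  (forall s t : R, 0 <= s -> s <= t -> t <= 1 ->
     Nl (rho t - rho s - tensor_curry (Phi s) (xi t - xi s))
       <= mu' * (t - s) `^ (2 * r)) ->
  (forall s t : R, 0 <= s -> s <= t -> t <= 1 ->
     Nb (Phi t - Phi s) <= mu' * (t - s) `^ r) ->
  forall s t : R, 0 <= s -> s < t -> t <= 1 ->
    cvg (compensated_sum xi Gamma rho Phi s t @ mesh_filter s t) /\
    Nn (rough_integral xi Gamma rho Phi s t
        - rho s (xi t - xi s) - Phi s (Gamma s t))
      <= C * mu * mu' * (t - s) `^ (3 * r).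
Proof.
have [r3 _] := andP hr.
have r0 : 0 < r by apply: lt_trans r3; rewrite divr_gt0.
(* Here [r > 1 / 3] enters: the sewing exponent exceeds one. *)
have theta1 : 1 < 3 * r by rewrite mulrC -ltr_pdivrMr.
(* The factor [2] counts the two terms of the germ's defect; the constant depends on [r] alone. *)
exists (sewing_const (3 * r) * 2).
move=> d n Nd Nt Nn Nl Nb xi Gamma mu rho Phi mu' hN hxi hGamma hchen hrho hPhi.
move=> s t s0 st t1.
have [mu0 mu'0] := holder_consts_ge0 hN hxi hPhi.
have K0 : 0 <= 2 * mu * mu' by rewrite !mulr_ge0.
have defect := rough_germ_defect hN r0 hxi hGamma hchen hrho hPhi.
rewrite /rough_integral compensated_sumE; split.
  exact (sewing_cvg (out_norm hN) theta1 K0 defect s0 st t1).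
have := sewing_lim_bound (out_norm hN) theta1 K0 defect s0 st t1.
by rewrite -addrA -opprD !mulrA.
Qed.
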